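(* Let $G$ be a finite group. Then: (i) $\mathsf{dcd}(G)\ge\mathsf{dcd}^*(G)$. (ii) $\max\{\mathsf{dcd}(H)\mid H\le G\}=\mathsf{GD}(G)-1$, where the maximum is over all subgroups $H$ of $G$.
   Context: For a finite group $G$, $\mathcal{F}(G)$ is the free abelian monoid with basis $G$, with operation $\cdot$; its elements are called sequences over $G$ (finite multisets of elements of $G$). For $S=g_1\cdot\ldots\cdot g_\ell\in\mathcal{F}(G)$, $|S|=\ell$ is the length, $\mathrm{supp}(S)=\{g_1,\dots,g_\ell\}$, and for $g\in\mathrm{supp}(S)$, $S\cdot g^{[-1]}$ denotes the sequence obtained from $S$ by removing one occurrence of $g$. $S$ is a product-one sequence if for some permutation $\pi$ of $\{1,\dots,\ell\}$ we have $g_{\pi(1)}\cdots g_{\pi(\ell)}=1_G$ in $G$; these form a submonoid $\mathcal{B}(G)$ of $\mathcal{F}(G)$. For $B\subseteq G$ and $g\in\langle B\rangle$ (the subgroup generated by $B$), $\ell_B(g)$ is the minimal $n\in\mathbb{Z}_{\ge 0}$ such that $g$ is a product of $n$ (not necessarily distinct) elements of $B$ ($\ell_B(1_G)=0$). The directed Cayley diameter is $\mathsf{dcd}(G):=\max\{\ell_B(g)\mid g\in G,\ B\subseteq G,\ \langle B\rangle=G\}$. An element $S\in\mathcal{B}(G)$ is a directed geodesic atom if there exists $g\in\mathrm{supp}(S)$ such that $\ell_{\mathrm{supp}(S\cdot g^{[-1]})}(g^{-1})=|S|-1$; $\mathcal{GA}(G)$ is the set of directed geodesic atoms. Set $\mathsf{GD}(G):=\max\{|S|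 : S\in\mathcal{GA}(G)\}$ and $\mathsf{dcd}^*(G):=\max\{|S| : S\in\mathcal{GA}(G),\ \langle\mathrm{supp}(S)\rangle=G\}-1$. *)

(* Defs.v *)
From mathcomp Require Import all_boot all_fingroup.
From mathcomp Require Import finmap multiset.

Set Implicit Arguments.
Unset Strict Implicit.
Unset Printing Implicit Defensive.

Local Open Scope group_scope.
Local Open Scope mset_scope.

Definition is_word_product (gT : finGroupType) (B : {set gT}) (g : gT)
    (n : nat) : bool :=
  [exists w : n.-tuple gT, all (mem B) w && (\prod_(x <- w) x == g)].

(* As the group is finite, inverses of elements of B are words in B, so the
   subgroup <<B>> is exactly the set of products of elements of B. *)
Lemma is_word_product_ex (gT : finGroupType) (B : {set gT}) (g : gT) :
  g \in <<B>> -> exists n, is_word_product B g n.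
Proof.
case/gen_prodgP=> n [c Bc ->]; exists n; apply/existsP.
exists [tuple c i | i < n]; apply/andP; split; last first.
  by rewrite big_tuple; apply/eqP/eq_bigr=> i _; rewrite tnth_mktuple.
by apply/allP=> x /mapP[i _ ->]; apply: Bc.
Qed.

(* The length is meaningful for g \in <<B>> only; elsewhere it is set to 0. *)
Definition word_length (gT : finGroupType) (B : {set gT}) (g : gT) : nat :=
  match @idP (g \in <<B>>) with
  | ReflectT gB => ex_minn (is_word_product_ex gB)
  | ReflectF _ => 0
  end.

Lemma word_lengthP (gT : finGroupType) (B : {set gT}) (g : gT) :
  g \in <<B>> ->
  is_word_product B g (word_length B g) /\
  forall n, is_word_product B g n -> word_length B g <= n.
Proof. by move=> gB; rewrite /word_length; case: {-}_ / idP => // ?; case: ex_minnP. Qed.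

(* A maximum over a finite set of pairs (B, g), which contains (G, 1). *)
Definition dcd (gT : finGroupType) (G : {group gT}) : nat :=
  \max_(B : {set gT} | (B \subset G) && (<<B>> == G))
    \max_(g in G) word_length B g.

Definition supp (gT : finGroupType) (S : {mset gT}) : {set gT} :=
  [set x | x \in S].

Definition product_one (gT : finGroupType) (S : {mset gT}) : bool :=
  has (fun s : seq gT => \prod_(x <- s) x == 1) (permutations S).

(* Since S is a product-one sequence, g^-1 lies in the subgroup generated by
   supp (S `\ g), so the default value of word_length is never used. *)
Definition geodesic_atom (gT : finGroupType) (G : {group gT})
    (S : {mset gT}) : bool :=
  [&& supp S \subset G, product_one S
    & [exists g in supp S,
        word_length (supp (S `\ g)) g^-1 == (size S - 1)%N]].

Definition generating_geodesic_atom (gT : finGroupType) (G : {group gT})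
    (S : {mset gT}) : bool :=
  geodesic_atom G S && (<<supp S>> == G).

(* n is the length of some S satisfying P: every multiset of cardinal n is the
   multiset of entries of an n-tuple. *)
Definition is_length_of (gT : finGroupType) (P : pred {mset gT})
    (n : nat) : bool :=
  [exists t : n.-tuple gT, P (seq_mset t)].

Lemma is_length_ofP (gT : finGroupType) (P : pred {mset gT}) (n : nat) :
  reflect (exists2 S : {mset gT}, P S & size S = n) (is_length_of P n).
Proof.
apply: (iffP existsP) => [[t Pt] | [S PS <-]].
  by exists (seq_mset t); rewrite // (perm_size (perm_eq_seq_mset t)) size_tuple.
by exists (in_tuple S); rewrite /= seq_mset_id.
Qed.

(* A crude bound; it only serves to show that the maxima below exist. *)
Definition atom_length_bound (gT : finGroupType) : nat :=
  (\max_(p : {set gT} * gT) word_length p.1 p.2).+1.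

Lemma geodesic_atom_bounded (gT : finGroupType) (G : {group gT}) (n : nat) :
  is_length_of (geodesic_atom G) n -> n <= atom_length_bound gT.
Proof.
case/is_length_ofP=> S /and3P[_ _ /existsP[g /andP[_ /eqP lenS]]] <-.
rewrite /atom_length_bound -add1n -leq_subLR -lenS.
exact: (leq_bigmax (supp (S `\ g), g^-1)).
Qed.

(* The product of an irredundant generating set B, taken in any order, has word
   length exactly #|B| over B. *)
Lemma generating_geodesic_atom_ex (gT : finGroupType) (G : {group gT}) :
  exists n, is_length_of (generating_geodesic_atom G) n.
Proof.
have [B /minsetP[/eqP genB minB] _] :=
  @minset_exists _ [pred B : {set gT} | <<B>> == G] G (introT eqP (genGid G)).
pose p := \prod_(x <- enum B) x.
pose S : {mset gT} := p^-1 +` seq_mset (enum B).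
have sBG : B \subset G by rewrite -genB subset_gen.
have pG : p \in G.
  rewrite /p big_seq; apply: group_prod => x.
  by rewrite mem_enum; apply: (subsetP sBG).
have pS : S `\ p^-1 = seq_mset (enum B) by rewrite /S msetD1K.
have permS : perm_eq S (p^-1 :: enum B).
  apply/eq_seq_msetP; rewrite seq_mset_id; apply/msetP=> x.
  by rewrite mset1DE !mset_seqE /= eq_sym.
have suppE : supp (seq_mset (enum B)) = B.
  by apply/setP=> x; rewrite inE (perm_mem (perm_eq_seq_mset _)) mem_enum.
have suppS : supp S = p^-1 |: B.
  by apply/setP=> x; rewrite in_set (perm_mem permS) !inE mem_enum.
have sizeS : size S = #|B|.+1 by rewrite (perm_size permS) /= cardE.
have lenp : word_length B p = #|B|.
  have pB : p \in <<B>> by rewrite genB.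
  have [/existsP[w /andP[/allP wB /eqP wp]] minp] := word_lengthP pB.
  apply/eqP; rewrite eqn_leq minp /=; last first.
    apply/existsP; exists (Tuple (introT eqP (esym (cardE B)))) => /=.
    by rewrite eqxx andbT; apply/allP=> x; rewrite mem_enum.
  rewrite leqNgt; apply/negP=> ltw.
  pose C := [set x in tval w].
  have ltC : #|C| < #|B|.
    by apply: leq_ltn_trans ltw; rewrite cardsE -[X in _ <= X](size_tuple w) card_size.
  have sCB : C \subset B by apply/subsetP=> x; rewrite inE => /wB.
  have /subsetPn[b Bb Cb] : ~~ (B \subset C).
    by apply/negP=> /subset_leq_card; rewrite leqNgt ltC.
  have sCD : C \subset B :\ b.
    apply/subsetP=> x Cx; rewrite !inE (subsetP sCB) // andbT.
    by apply: contraNneq Cb => <-.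
  have pD : p \in <<B :\ b>>.
    rewrite -wp big_seq; apply: group_prod => x wx.
    by apply/mem_gen/(subsetP sCD); rewrite inE.
  have bBb : b \in <<B :\ b>>.
    have eB: b \in enum B by rewrite mem_enum.
    have [s1 [s2 defB]] : exists s1, exists s2, enum B = s1 ++ b :: s2.
      by case/splitPr: eB => s1 s2; exists s1, s2.
    have := enum_uniq B; rewrite defB uniq_catC /= mem_cat => /andP[nbs _].
    have sD s : {subset s <= enum B} -> b \notin s ->
        \prod_(x <- s) x \in <<B :\ b>>.
      move=> sB bs; rewrite big_seq; apply: group_prod => x xs; apply/mem_gen.
      rewrite !inE -(mem_enum B) sB // andbT.
      by apply: contraNneq bs => <-.
    have p1D := sD s1; have p2D := sD s2.
    have := pD; rewrite /p defB big_cat big_cons /= groupMl ?groupMr //.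
      apply: p2D => [x xs|]; first by rewrite defB mem_cat inE xs !orbT.
      by apply: contraNN nbs => ->.
    apply: p1D => [x xs|]; first by rewrite defB mem_cat xs.
    by apply: contraNN nbs => ->; rewrite orbT.
  have /minB : <<B :\ b>> == G.
    rewrite eqEsubset gen_subG (subset_trans (subsetDl _ _)) //= -genB gen_subG.
    by apply/subsetP=> x Bx; case: (eqVneq x b) => [-> //|xb]; apply/mem_gen; rewrite !inE xb.
  by move=> /(_ (subsetDl _ _)) eqB; rewrite -eqB !inE eqxx in Bb.
exists #|B|.+1; apply/is_length_ofP; exists S => //.
rewrite /generating_geodesic_atom /geodesic_atom suppS; apply/andP; split; last first.
  by rewrite eqEsubset gen_subG subUset sub1set groupV pG sBG -{1}genB genS ?subsetUr.
apply/and3P; split.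
- by rewrite subUset sub1set groupV pG.
- apply/hasP; exists (p^-1 :: enum B); last by rewrite big_cons mulVg.
  by rewrite mem_permutations perm_sym.
- apply/existsP; exists p^-1; rewrite !inE eqxx /=.
  by rewrite pS suppE invgK lenp sizeS subn1.
Qed.

Lemma geodesic_atom_ex (gT : finGroupType) (G : {group gT}) :
  exists n, is_length_of (geodesic_atom G) n.
Proof.
have [n /is_length_ofP[S /andP[GS _] sizeS]] := generating_geodesic_atom_ex G.
by exists n; apply/is_length_ofP; exists S.
Qed.

Lemma generating_geodesic_atom_bounded (gT : finGroupType) (G : {group gT})
    (n : nat) :
  is_length_of (generating_geodesic_atom G) n -> n <= atom_length_bound gT.
Proof.
case/is_length_ofP=> S /andP[GS _] sizeS; apply: (@geodesic_atom_bounded _ G).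
by apply/is_length_ofP; exists S.
Qed.

Definition GD (gT : finGroupType) (G : {group gT}) : nat :=
  ex_maxn (geodesic_atom_ex G) (@geodesic_atom_bounded gT G).

Definition dcd_star (gT : finGroupType) (G : {group gT}) : nat :=
  ex_maxn (generating_geodesic_atom_ex G)
          (@generating_geodesic_atom_bounded gT G) - 1.

(* Atoms are nonempty, so the truncated subtractions of 1 are exact. *)
Lemma geodesic_atom_size_gt0 (gT : finGroupType) (G : {group gT})
    (S : {mset gT}) : geodesic_atom G S -> 0 < size S.
Proof.
case/and3P=> _ _ /existsP[g /andP[gS _]]; rewrite inE in gS.
case: posnP => // /size0nil S0.
by have : g \in enum_mset S := gS; rewrite S0.
Qed.

(* Main.v *)
(* Removing a suitable term g from a product-one sequence and rotating leaves a
   word w with product g^-1, so directed geodesic atoms are exactly the sequences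
   w . (prod w)^-1 with w a shortest word over its own letters.  The letters of w
   generate the same subgroup as the atom, which bounds |w| by its directed
   diameter.  Conversely, a shortest word over any B stays shortest over the set
   of letters it uses, hence yields an atom. *)
Require Import Defs.
From mathcomp Require Import all_boot all_fingroup.
From mathcomp Require Import finmap multiset.

Set Implicit Arguments.
Unset Strict Implicit.
Unset Printing Implicit Defensive.

Local Open Scope group_scope.
Local Open Scope mset_scope.

Section GeodesicAtoms.

Variable gT : finGroupType.
Implicit Types (G H : {group gT}) (B C : {set gT}) (g : gT) (w : seq gT).
Implicit Types S : {mset gT}.

Lemma is_word_productP B g n :
  reflect (exists w, [/\ {subset w <= B}, \prod_(x <- w) x = g & size w = n])
          (is_word_product B g n).
Proof.
apply: (iffP existsP) => [[t /andP[/allP tB /eqP tg]] | [w [wB wg <-]]].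
  by exists t; rewrite size_tuple.
by exists (in_tuple w); rewrite /= wg eqxx andbT; apply/allP.
Qed.

Lemma mem_gen_prod B w : {subset w <= B} -> \prod_(x <- w) x \in <<B>>.
Proof.
by move=> wB; rewrite big_seq; apply: group_prod => x /wB; apply: mem_gen.
Qed.

Lemma word_length_prod_le B w :
  {subset w <= B} -> word_length B (\prod_(x <- w) x) <= size w.
Proof.
move=> wB; have [_] := word_lengthP (mem_gen_prod wB); apply.
by apply/is_word_productP; exists w.
Qed.

Lemma shortest_word B g : g \in <<B>> ->
  exists w, [/\ {subset w <= B}, \prod_(x <- w) x = g
              & size w = word_length B g].
Proof. by case/word_lengthP=> /is_word_productP. Qed.

(** A shortest word over [C] is also a word over [B]. Membership in [<<C>>] matters: outside it
    [word_length C g] takes the default value 0. *)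
Lemma word_length_subset B C g :
  C \subset B -> g \in <<C>> -> word_length B g <= word_length C g.
Proof.
move=> /subsetP sCB /shortest_word[w [wC <- <-]].
by apply: word_length_prod_le => x /wC /sCB.
Qed.

Lemma supp_seq_mset w : supp (seq_mset w) = [set x in w].
Proof. by apply/setP=> x; rewrite !inE (perm_mem (perm_eq_seq_mset _)). Qed.

Lemma size_seq_mset w : size (seq_mset w) = size w.
Proof. exact/perm_size/perm_eq_seq_mset. Qed.

Lemma seq_mset_consD1 g w : seq_mset (g :: w) `\ g = seq_mset w.
Proof.
suff ->: seq_mset (g :: w) = g +` seq_mset w by rewrite msetD1K.
by apply/msetP=> x; rewrite mset1DE !mset_seqE /= eq_sym.
Qed.

Lemma product_one_rot S g : product_one S -> g \in supp S ->
  exists2 w, S = seq_mset (g :: w) & \prod_(x <- w) x = g^-1.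
Proof.
case/hasP=> s; rewrite mem_permutations => sS /eqP s1; rewrite inE => gS.
have gs : g \in s by rewrite (perm_mem sS).
case/splitPr: gs s1 sS => s1 s2 prod1 permS.
(* Rotating [s1 ++ g :: s2] into [g :: s2 ++ s1] keeps the product equal to 1. *)
exists (s2 ++ s1).
  rewrite -[S]seq_mset_id; apply/eq_seq_msetP; rewrite perm_sym.
  by apply: perm_trans permS; rewrite -cat_cons perm_catC.
move: prod1; rewrite !big_cat big_cons /= => /eqP.
rewrite -eq_invg_mul => /eqP inv_s1; rewrite -[X in _ * X]invgK inv_s1.
by rewrite invMg mulKVg.
Qed.

(** Trades multisets and orderings for a single word, whose letters form the support left after the
    distinguished term is removed. *)
Lemma geodesic_atomP G S :
  reflect (exists w, [/\ {subset w <= G},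
                         word_length [set x in w] (\prod_(x <- w) x) = size w
                       & S = seq_mset ((\prod_(x <- w) x)^-1 :: w)])
          (geodesic_atom G S).
Proof.
apply: (iffP idP) => [/and3P[SG S1 /existsP[g /andP[gS]]] | [w [wG wlen ->]]].
  have [w defS prodw] := product_one_rot S1 gS.
  rewrite defS seq_mset_consD1 supp_seq_mset size_seq_mset /= subn1 -prodw.
  move=> /eqP wlen; exists w; split=> //; last by rewrite prodw invgK.
  move=> x wx; apply: (subsetP SG).
  by rewrite defS supp_seq_mset !inE wx orbT.
set g := \prod_(x <- w) x; apply/and3P; split.
- rewrite supp_seq_mset; apply/subsetP=> x; rewrite !inE => /predU1P[->|/wG//].
  by rewrite groupV /g big_seq; apply: group_prod => y /wG.
- apply/hasP; exists (g^-1 :: w); last by rewrite big_cons mulVg.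
  by rewrite mem_permutations perm_sym perm_eq_seq_mset.
apply/existsP; exists g^-1; rewrite supp_seq_mset !inE eqxx /=.
by rewrite seq_mset_consD1 supp_seq_mset size_seq_mset /= subn1 invgK wlen.
Qed.

Lemma leq_dcd G B g : <<B>> = G -> g \in G -> word_length B g <= dcd G.
Proof.
move=> genB gG; apply: (@leq_trans (\max_(h in G) word_length B h)).
  exact: leq_bigmax_cond.
rewrite /dcd (bigD1 B) ?leq_maxl //=.
by rewrite -genB subset_gen eqxx.
Qed.

(** The group [H] is kept apart from [G] so that the bound serves both parts: [H] is [G] itself in
    (i) and a subgroup of [G] in (ii). *)
Lemma geodesic_atom_size_le G H S :
  geodesic_atom G S -> <<supp S>> = H -> size S <= (dcd H).+1.
Proof.
case/geodesic_atomP=> w [_ wlen ->]; rewrite supp_seq_mset size_seq_mset /=.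
have wgen : \prod_(x <- w) x \in <<[set x in w]>>.
  by apply: mem_gen_prod => x; rewrite inE.
move=> genH; rewrite ltnS -wlen.
(* The remaining term of the atom is the inverse of the product of [w], so it adds nothing to the
   subgroup generated by the letters. *)
have genw : <<[set x in w]>> = H.
  rewrite -genH; apply/eqP; rewrite eqEsubset; apply/andP; split.
    by apply/genS/subsetP=> x; rewrite !inE => ->; rewrite orbT.
  rewrite gen_subG; apply/subsetP=> x; rewrite !inE.
  by case/predU1P=> [-> | wx]; rewrite ?groupV // mem_gen ?inE.
by apply: leq_dcd; rewrite -?genw.
Qed.

Lemma geodesic_atom_of_word_length G B g : B \subset G -> g \in <<B>> ->
  exists2 S, geodesic_atom G S & size S = (word_length B g).+1.
Proof.
move=> sBG /shortest_word[w [wB prodw lenw]].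
exists (seq_mset (g^-1 :: w)); last by rewrite size_seq_mset /= lenw.
have sww : {subset w <= [set x in w]} by move=> x; rewrite inE.
apply/geodesic_atomP; exists w; split; last by rewrite prodw.
  by move=> x /wB; apply: subsetP.
(* The word [w] itself gives the upper bound; for the lower bound, passing from [B] to fewer
   generators cannot shorten words. *)
apply/eqP; rewrite eqn_leq word_length_prod_le //= lenw prodw.
apply: word_length_subset; last by rewrite -prodw mem_gen_prod.
by apply/subsetP=> x; rewrite inE => /wB.
Qed.

End GeodesicAtoms.

Theorem lemma5p5 (gT : finGroupType) (G : {group gT}) :
  (dcd_star G <= dcd G)%N /\
  (\max_(H : {group gT} | H \subset G) dcd H = GD G - 1)%N.
Proof.
split.
  rewrite /dcd_star; case: ex_maxnP => _ /is_length_ofP[S /andP[atomS genS] <-] _.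
  by rewrite leq_subLR add1n; apply: geodesic_atom_size_le atomS (eqP genS).
rewrite /GD; case: ex_maxnP => n /is_length_ofP[S0 atom0 size0] maxn.
apply/eqP; rewrite eqn_leq; apply/andP; split.
  apply/bigmax_leqP=> H sHG; apply/bigmax_leqP=> B /andP[sBH /eqP genB].
  apply/bigmax_leqP=> g; rewrite -genB => gB.
  have [S atomS sizeS] := geodesic_atom_of_word_length (subset_trans sBH sHG) gB.
  (* The subtraction is exact because [n] is the length of the atom [S0], hence positive. *)
  rewrite -ltnS subn1 -sizeS prednK.
    by apply: maxn; apply/is_length_ofP; exists S.
  by rewrite -size0 (geodesic_atom_size_gt0 atom0).
rewrite leq_subLR add1n -size0.
(* The subgroup generated by a longest atom already has a large enough directed diameter. *)
have sSG : <<supp S0>> \subset G by rewrite gen_subG; case/and3P: atom0.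
apply: leq_trans (geodesic_atom_size_le atom0 (erefl (gval <<supp S0>>%G))) _.
by rewrite ltnS (bigD1 <<supp S0>>%G) ?leq_maxl.
Qed.
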